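(* The maximal Lie invariance algebra $\mathfrak g_0$ of the system $\mathcal S_0$ $$u_t+uu_x+v_x=0,\qquad v_t+uv_x+u_x=0$$ for unknown functions $u,v$ of $(t,x)$ is spanned by the vector fields $$\breve{\mathcal D}=t\partial_t+x\partial_x,\quad \breve{\mathcal G}=t\partial_x+\partial_u,\quad \breve{\mathcal P}(\tau^0,\xi^0)=\tau^0(u,v)\partial_t+\xi^0(u,v)\partial_x,\quad \breve{\mathcal P}^v=\partial_v,$$ $$\breve{\mathcal J}=\left(\tfrac12x-tu\right)\partial_t+t\left(v-\tfrac12u^2+\tfrac12\right)\partial_x+v\partial_u+u\partial_v,$$ where $(\tau^0,\xi^0)$ runs through the solution set of the system $u\tau^0_u-\tau^0_v=\xi^0_u$, $u\tau^0_v-\tau^0_u=\xi^0_v$.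
   Context: The maximal Lie invariance algebra of a first-order system of PDEs for $(u,v)$ is the Lie algebra of all vector fields $Q=\tau\partial_t+\xi\partial_x+\eta\partial_u+\theta\partial_v$, with coefficients smooth functions of $(t,x,u,v)$, whose first prolongation $Q^{(1)}$ to the first-order jet space annihilates the left-hand side of each equation of the system on the submanifold of the jet space defined by the system. ''Spanned'' means that every element is a linear combination, with constant coefficients, of the listed vector fields. Subscripts on functions denote partial derivatives. *)

(* Defs.v *)
From Stdlib Require Import Reals List.
From Coquelicot Require Import Coquelicot.
Import ListNotations.
Open Scope R_scope.

Definition fun4 := R -> R -> R -> R -> R.

Definition d_t (f : fun4) : fun4 := fun t x u v => Derive (fun s => f s x u v) t.
Definition d_x (f : fun4) : fun4 := fun t x u v => Derive (fun s => f t s u v) x.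
Definition d_u (f : fun4) : fun4 := fun t x u v => Derive (fun s => f t x s v) u.
Definition d_v (f : fun4) : fun4 := fun t x u v => Derive (fun s => f t x u s) v.

Definition jointly_continuous (f : fun4) : Prop :=
  forall p : R * R * R * R,
    continuous (fun q : R * R * R * R => let '(t, x, u, v) := q in f t x u v) p.

(* [Derive] is total, so the existence of the partial derivatives has to be
   required separately. *)
Definition has_partials (f : fun4) : Prop :=
  forall t x u v,
    ex_derive (fun s => f s x u v) t /\ ex_derive (fun s => f t s u v) x /\
    ex_derive (fun s => f t x s v) u /\ ex_derive (fun s => f t x u s) v.

Fixpoint class_C (n : nat) (f : fun4) : Prop :=
  jointly_continuous f /\
  match n with
  | O => True
  | S m => has_partials f /\
      class_C m (d_t f) /\ class_C m (d_x f) /\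
      class_C m (d_u f) /\ class_C m (d_v f)
  end.

Definition smooth (f : fun4) : Prop := forall n : nat, class_C n f.

(* [tau d/dt + xi d/dx + eta d/du + theta d/dv] *)
Record vector_field := VF { tau : fun4; xi : fun4; eta : fun4; theta : fun4 }.

Definition smooth_vf (Q : vector_field) : Prop :=
  smooth (tau Q) /\ smooth (xi Q) /\ smooth (eta Q) /\ smooth (theta Q).

Definition vf_zero : vector_field :=
  VF (fun _ _ _ _ => 0) (fun _ _ _ _ => 0) (fun _ _ _ _ => 0) (fun _ _ _ _ => 0).

Definition vf_plus (X Y : vector_field) : vector_field :=
  VF (fun t x u v => tau X t x u v + tau Y t x u v)
     (fun t x u v => xi X t x u v + xi Y t x u v)
     (fun t x u v => eta X t x u v + eta Y t x u v)
     (fun t x u v => theta X t x u v + theta Y t x u v).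

Definition vf_scal (c : R) (X : vector_field) : vector_field :=
  VF (fun t x u v => c * tau X t x u v)
     (fun t x u v => c * xi X t x u v)
     (fun t x u v => c * eta X t x u v)
     (fun t x u v => c * theta X t x u v).

Definition lin_comb (l : list (R * vector_field)) : vector_field :=
  fold_right (fun cX Y => vf_plus (vf_scal (fst cX) (snd cX)) Y) vf_zero l.

Definition span (G : vector_field -> Prop) (Q : vector_field) : Prop :=
  exists l : list (R * vector_field),
    List.Forall (fun cX => G (snd cX)) l /\ Q = lin_comb l.

(* Functions on the first-order jet space, with the coordinates in the order
   t, x, u, v, u_t, u_x, v_t, v_x. *)
Definition jet_fun := R -> R -> R -> R -> R -> R -> R -> R -> R.

(* Restrictions to functions of (t,x,u,v) of the total derivatives
   D_t = d_t + u_t d_u + v_t d_v + ...  and  D_x = d_x + u_x d_u + v_x d_v + ... *)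
Definition total_t (f : fun4) : jet_fun := fun t x u v ut _ vt _ =>
  d_t f t x u v + ut * d_u f t x u v + vt * d_v f t x u v.
Definition total_x (f : fun4) : jet_fun := fun t x u v _ ux _ vx =>
  d_x f t x u v + ux * d_u f t x u v + vx * d_v f t x u v.

(* Coefficients of d/du_t, d/du_x (for [phi = eta Q], [w = u]) and of
   d/dv_t, d/dv_x (for [phi = theta Q], [w = v]) in the first prolongation:
   D_i phi - w_t D_i tau - w_x D_i xi. *)
Definition eta_t (Q : vector_field) : jet_fun := fun t x u v ut ux vt vx =>
  total_t (eta Q) t x u v ut ux vt vx
  - ut * total_t (tau Q) t x u v ut ux vt vx
  - ux * total_t (xi Q) t x u v ut ux vt vx.
Definition eta_x (Q : vector_field) : jet_fun := fun t x u v ut ux vt vx =>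
  total_x (eta Q) t x u v ut ux vt vx
  - ut * total_x (tau Q) t x u v ut ux vt vx
  - ux * total_x (xi Q) t x u v ut ux vt vx.
Definition theta_t (Q : vector_field) : jet_fun := fun t x u v ut ux vt vx =>
  total_t (theta Q) t x u v ut ux vt vx
  - vt * total_t (tau Q) t x u v ut ux vt vx
  - vx * total_t (xi Q) t x u v ut ux vt vx.
Definition theta_x (Q : vector_field) : jet_fun := fun t x u v ut ux vt vx =>
  total_x (theta Q) t x u v ut ux vt vx
  - vt * total_x (tau Q) t x u v ut ux vt vx
  - vx * total_x (xi Q) t x u v ut ux vt vx.

Definition prolong1 (Q : vector_field) (F : jet_fun) : jet_fun :=
  fun t x u v ut ux vt vx =>
    tau Q t x u v * Derive (fun s => F s x u v ut ux vt vx) t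
  + xi Q t x u v * Derive (fun s => F t s u v ut ux vt vx) x
  + eta Q t x u v * Derive (fun s => F t x s v ut ux vt vx) u
  + theta Q t x u v * Derive (fun s => F t x u s ut ux vt vx) v
  + eta_t Q t x u v ut ux vt vx * Derive (fun s => F t x u v s ux vt vx) ut
  + eta_x Q t x u v ut ux vt vx * Derive (fun s => F t x u v ut s vt vx) ux
  + theta_t Q t x u v ut ux vt vx * Derive (fun s => F t x u v ut ux s vx) vt
  + theta_x Q t x u v ut ux vt vx * Derive (fun s => F t x u v ut ux vt s) vx.

(* A first-order system is the list of the left-hand sides of its equations. *)
Definition max_lie_invariance_algebra (S : list jet_fun) (Q : vector_field) : Prop :=
  smooth_vf Q /\
  forall F, In F S ->
  forall t x u v ut ux vt vx,
    (forall F', In F' S -> F' t x u v ut ux vt vx = 0) ->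
    prolong1 Q F t x u v ut ux vt vx = 0.

Definition S0 : list jet_fun :=
  [ (fun t x u v ut ux vt vx => ut + u * ux + vx);
    (fun t x u v ut ux vt vx => vt + u * vx + ux) ].

Definition vf_D : vector_field :=
  VF (fun t x u v => t) (fun t x u v => x) (fun _ _ _ _ => 0) (fun _ _ _ _ => 0).

Definition vf_G : vector_field :=
  VF (fun _ _ _ _ => 0) (fun t x u v => t) (fun _ _ _ _ => 1) (fun _ _ _ _ => 0).

Definition vf_P (tau0 xi0 : R -> R -> R) : vector_field :=
  VF (fun t x u v => tau0 u v) (fun t x u v => xi0 u v)
     (fun _ _ _ _ => 0) (fun _ _ _ _ => 0).

Definition vf_Pv : vector_field :=
  VF (fun _ _ _ _ => 0) (fun _ _ _ _ => 0) (fun _ _ _ _ => 0) (fun _ _ _ _ => 1).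

Definition vf_J : vector_field :=
  VF (fun t x u v => / 2 * x - t * u)
     (fun t x u v => t * (v - / 2 * u ^ 2 + / 2))
     (fun t x u v => v)
     (fun t x u v => u).

(* Smoothness of a function of (u,v) is smoothness of the function of (t,x,u,v)
   that it defines. *)
Definition P_solution (tau0 xi0 : R -> R -> R) : Prop :=
  smooth (fun _ _ u v => tau0 u v) /\ smooth (fun _ _ u v => xi0 u v) /\
  forall u v,
    u * Derive (fun s => tau0 s v) u - Derive (fun s => tau0 u s) v
      = Derive (fun s => xi0 s v) u /\
    u * Derive (fun s => tau0 u s) v - Derive (fun s => tau0 s v) u
      = Derive (fun s => xi0 u s) v.

Inductive g0_generator : vector_field -> Prop :=
| gen_D : g0_generator vf_D
| gen_G : g0_generator vf_G
| gen_P tau0 xi0 : P_solution tau0 xi0 -> g0_generator (vf_P tau0 xi0)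
| gen_Pv : g0_generator vf_Pv
| gen_J : g0_generator vf_J.

(* Main.v *)
(* Restricted to the system, the invariance condition is polynomial in the free
   jet coordinates (u_x, v_x); splitting it yields the linear system [determining].
   Its eta-theta part forces eta and theta to be independent of t and x. Since
   the four partial derivatives of xi are given in terms of tau and eta, equality
   of mixed derivatives gives eta_u = 0, 2 tau_x = eta_v, tau_tu = - eta_v and
   tau_tv = tau_tt = 0. Hence eta_v = theta_u is a constant c, eta = c v + a,
   theta = c u + b, tau_x = c/2 and tau_t = d - c u, and (tau, xi) is known up to
   functions of (u, v) alone, which solve the system of the statement. *)

From Stdlib Require Import Reals List Lra FunctionalExtensionality.
From Coquelicot Require Import Coquelicot.
Require Import Defs.
Import ListNotations.
Open Scope R_scope.

(** * Partial derivatives indexed by the coordinate axes *)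

Inductive axis := T | X | U | V.

Definition pd (i : axis) : fun4 -> fun4 :=
  match i with T => d_t | X => d_x | U => d_u | V => d_v end.

(** Restriction of [f] to the line through the given point parallel to axis [i], parametrized by the
    value [s] of that coordinate. *)
Definition slice (i : axis) (f : fun4) (t x u v s : R) : R :=
  match i with T => f s x u v | X => f t s u v | U => f t x s v | V => f t x u s end.

Definition coord (i : axis) : fun4 :=
  fun t x u v => match i with T => t | X => x | U => u | V => v end.

Lemma pd_Derive i f t x u v :
  pd i f t x u v = Derive (slice i f t x u v) (coord i t x u v).
Proof. now destruct i. Qed.

(** Recasts one step of the recursion as a statement quantified over [axis], so that inductions on
    [n] handle all four variables at once. *)
Lemma class_C_S n f :
  class_C (S n) f <->
  jointly_continuous f /\
  (forall i t x u v, ex_derive (slice i f t x u v) (coord i t x u v)) /\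
  (forall i, class_C n (pd i f)).
Proof.
  split.
  - intros [Hc [Hp [Ht [Hx [Hu Hv]]]]]; split; [exact Hc|split].
    + intros i t x u v; destruct (Hp t x u v) as [? [? [? ?]]]; now destruct i.
    + now intros [].
  - intros [Hc [Hp Hd]]; split; [exact Hc|split].
    + intros t x u v; split; [exact (Hp T t x u v)|].
      split; [exact (Hp X t x u v)|]; split; [exact (Hp U t x u v)|exact (Hp V t x u v)].
    + exact (conj (Hd T) (conj (Hd X) (conj (Hd U) (Hd V)))).
Qed.

Lemma class_C_continuous n f : class_C n f -> jointly_continuous f.
Proof. now destruct n; intros []. Qed.

Lemma class_C_pred n f : class_C (S n) f -> class_C n f.
Proof.
  revert f; induction n as [|n IH]; intros f H; apply class_C_S in H as [Hc [Hp Hd]].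
  - now split.
  - apply class_C_S; auto.
Qed.

Lemma smooth_pd i f : smooth f -> smooth (pd i f).
Proof. intros H n; exact (proj2 (proj2 (proj1 (class_C_S n f) (H (S n)))) i). Qed.

Lemma smooth_ex_derive i f t x u v :
  smooth f -> ex_derive (slice i f t x u v) (coord i t x u v).
Proof. intros H; exact (proj1 (proj2 (proj1 (class_C_S 0 f) (H 1%nat))) i t x u v). Qed.

(** * Closure of the smooth functions under sums and products *)

Lemma jointly_continuous_const c : jointly_continuous (fun _ _ _ _ => c).
Proof.
  intros p; apply continuous_ext with (fun _ => c); [now intros [[[? ?] ?] ?]|].
  apply continuous_const.
Qed.

Lemma jointly_continuous_coord i : jointly_continuous (coord i).
Proof.
  intros p.
  destruct i.
  - apply continuous_ext with (fun q : R * R * R * R => fst (fst (fst q)));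
      [now intros [[[? ?] ?] ?]|].
    apply (continuous_comp (fun q : R * R * R * R => fst (fst q)) fst);
      [apply (continuous_comp (fun q : R * R * R * R => fst q) fst)|]; apply continuous_fst.
  - apply continuous_ext with (fun q : R * R * R * R => snd (fst (fst q)));
      [now intros [[[? ?] ?] ?]|].
    apply (continuous_comp (fun q : R * R * R * R => fst (fst q)) snd);
      [apply (continuous_comp (fun q : R * R * R * R => fst q) fst); apply continuous_fst
      |apply continuous_snd].
  - apply continuous_ext with (fun q : R * R * R * R => snd (fst q));
      [now intros [[[? ?] ?] ?]|].
    apply (continuous_comp (fun q : R * R * R * R => fst q) snd);
      [apply continuous_fst|apply continuous_snd].
  - apply continuous_ext with (fun q : R * R * R * R => snd q);
      [now intros [[[? ?] ?] ?]|].
    apply continuous_snd.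
Qed.

Lemma jointly_continuous_plus f g :
  jointly_continuous f -> jointly_continuous g ->
  jointly_continuous (fun t x u v => f t x u v + g t x u v).
Proof.
  intros Hf Hg p.
  eapply continuous_ext; [|exact (continuous_plus _ _ p (Hf p) (Hg p))].
  now intros [[[? ?] ?] ?].
Qed.

Lemma jointly_continuous_mult f g :
  jointly_continuous f -> jointly_continuous g ->
  jointly_continuous (fun t x u v => f t x u v * g t x u v).
Proof.
  intros Hf Hg p.
  eapply continuous_ext; [|exact (continuous_mult (K := R_AbsRing) _ _ p (Hf p) (Hg p))].
  now intros [[[? ?] ?] ?].
Qed.

Lemma ex_derive_slice_plus i f g t x u v :
  ex_derive (slice i f t x u v) (coord i t x u v) ->
  ex_derive (slice i g t x u v) (coord i t x u v) ->
  ex_derive (slice i (fun t x u v => f t x u v + g t x u v) t x u v) (coord i t x u v) /\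
  pd i (fun t x u v => f t x u v + g t x u v) t x u v = pd i f t x u v + pd i g t x u v.
Proof.
  intros Hf Hg; split.
  - destruct i; exact (ex_derive_plus _ _ _ Hf Hg).
  - rewrite !pd_Derive; destruct i; exact (Derive_plus _ _ _ Hf Hg).
Qed.

Lemma ex_derive_slice_mult i f g t x u v :
  ex_derive (slice i f t x u v) (coord i t x u v) ->
  ex_derive (slice i g t x u v) (coord i t x u v) ->
  ex_derive (slice i (fun t x u v => f t x u v * g t x u v) t x u v) (coord i t x u v) /\
  pd i (fun t x u v => f t x u v * g t x u v) t x u v
    = pd i f t x u v * g t x u v + f t x u v * pd i g t x u v.
Proof.
  intros Hf Hg; split.
  - destruct i; exact (ex_derive_mult _ _ _ Hf Hg).
  - rewrite !pd_Derive; destruct i; exact (Derive_mult _ _ _ Hf Hg).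
Qed.

Lemma pd_const i c t x u v : pd i (fun _ _ _ _ => c) t x u v = 0.
Proof. destruct i; exact (Derive_const _ _). Qed.

Definition axis_eq_dec (i j : axis) : {i = j} + {i <> j}.
Proof. decide equality. Defined.

Lemma pd_coord i j t x u v :
  pd i (coord j) t x u v = if axis_eq_dec i j then 1 else 0.
Proof. destruct i, j; first [exact (Derive_id _)|exact (Derive_const _ _)]. Qed.

(** Equality of functions proper is required twice: [pd] and [class_C] take functions as arguments,
    and [span] asks for equality of vector fields. *)
Lemma fun4_ext (f g : fun4) : (forall t x u v, f t x u v = g t x u v) -> f = g.
Proof.
  intros H; do 4 (apply functional_extensionality; intro); apply H.
Qed.

Lemma smooth_const c : smooth (fun _ _ _ _ => c).
Proof.
  intros n; revert c; induction n as [|n IH]; intros c.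
  - split; [apply jointly_continuous_const|exact I].
  - apply class_C_S; split; [apply jointly_continuous_const|split].
    + intros i t x u v; destruct i; exact (ex_derive_const c _).
    + intros i; replace (pd i _) with (fun _ _ _ _ : R => 0); [apply IH|].
      apply fun4_ext; intros; now rewrite pd_const.
Qed.

Lemma smooth_coord j : smooth (coord j).
Proof.
  intros [|n].
  - split; [apply jointly_continuous_coord|exact I].
  - apply class_C_S; split; [apply jointly_continuous_coord|split].
    + intros i t x u v; destruct i, j; first [exact (ex_derive_id _)|exact (ex_derive_const _ _)].
    + intros i.
      replace (pd i _) with (fun _ _ _ _ : R => if axis_eq_dec i j then 1 else 0);
        [apply smooth_const|].
      apply fun4_ext; intros; now rewrite pd_coord.
Qed.

Lemma class_C_plus n f g :
  class_C n f -> class_C n g -> class_C n (fun t x u v => f t x u v + g t x u v).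
Proof.
  revert f g; induction n as [|n IH]; intros f g Hf Hg.
  - split; [|exact I].
    apply jointly_continuous_plus; eapply class_C_continuous; eassumption.
  - apply class_C_S in Hf as [cf [pf df]]; apply class_C_S in Hg as [cg [pg dg]].
    apply class_C_S; split; [now apply jointly_continuous_plus|split].
    + intros i t x u v; now apply ex_derive_slice_plus.
    + intros i; rewrite (fun4_ext _ (fun t x u v => pd i f t x u v + pd i g t x u v));
        [now apply IH|].
      intros; now apply ex_derive_slice_plus.
Qed.

Lemma class_C_mult n f g :
  class_C n f -> class_C n g -> class_C n (fun t x u v => f t x u v * g t x u v).
Proof.
  revert f g; induction n as [|n IH]; intros f g Hf Hg.
  - split; [|exact I].
    apply jointly_continuous_mult; eapply class_C_continuous; eassumption.
  (* The Leibniz rule multiplies derivatives, of class [n], by the factors themselves, whose class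
     is therefore lowered from [S n] to [n]. *)
  - pose proof (class_C_pred _ _ Hf) as Hf'; pose proof (class_C_pred _ _ Hg) as Hg'.
    apply class_C_S in Hf as [cf [pf df]]; apply class_C_S in Hg as [cg [pg dg]].
    apply class_C_S; split; [now apply jointly_continuous_mult|split].
    + intros i t x u v; now apply ex_derive_slice_mult.
    + intros i; rewrite (fun4_ext _ (fun t x u v =>
        pd i f t x u v * g t x u v + f t x u v * pd i g t x u v));
        [apply class_C_plus; now apply IH|].
      intros; now apply ex_derive_slice_mult.
Qed.

Lemma smooth_plus f g :
  smooth f -> smooth g -> smooth (fun t x u v => f t x u v + g t x u v).
Proof. intros Hf Hg n; now apply class_C_plus. Qed.

Lemma smooth_mult f g :
  smooth f -> smooth g -> smooth (fun t x u v => f t x u v * g t x u v).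
Proof. intros Hf Hg n; now apply class_C_mult. Qed.

Lemma pd_plus i f g t x u v :
  smooth f -> smooth g ->
  pd i (fun t x u v => f t x u v + g t x u v) t x u v = pd i f t x u v + pd i g t x u v.
Proof. intros Hf Hg; now apply ex_derive_slice_plus; apply smooth_ex_derive. Qed.

Lemma pd_mult i f g t x u v :
  smooth f -> smooth g ->
  pd i (fun t x u v => f t x u v * g t x u v) t x u v
    = pd i f t x u v * g t x u v + f t x u v * pd i g t x u v.
Proof. intros Hf Hg; now apply ex_derive_slice_mult; apply smooth_ex_derive. Qed.

(** * Symmetry of mixed partial derivatives *)

Lemma continuous_pair {A B C : UniformSpace} (f : A -> B) (g : A -> C) p :
  continuous f p -> continuous g p -> continuous (fun q => (f q, g q)) p.
Proof.
  intros Hf Hg; apply (continuous_comp_2 f g (@pair B C)); [exact Hf|exact Hg|].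
  apply continuous_ext with (fun q => q); [now intros []|apply continuous_id].
Qed.

(** Provides the continuity hypotheses of [Schwarz] on a coordinate plane, where two of [a], [b],
    [c], [d] are the projections and the others are constant. *)
Lemma jointly_continuous_2d f (a b c d : R * R -> R) y z :
  jointly_continuous f ->
  (forall p, continuous a p) -> (forall p, continuous b p) ->
  (forall p, continuous c p) -> (forall p, continuous d p) ->
  continuity_2d_pt (fun r s => f (a (r, s)) (b (r, s)) (c (r, s)) (d (r, s))) y z.
Proof.
  intros Hf Ha Hb Hc Hd; apply continuity_2d_pt_filterlim.
  change (continuous (fun q : R * R => f (a (fst q, snd q)) (b (fst q, snd q))
    (c (fst q, snd q)) (d (fst q, snd q))) (y, z)).
  apply continuous_ext with (fun q => f (a q) (b q) (c q) (d q)); [now intros []|].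
  apply (continuous_comp (fun q => (a q, b q, c q, d q))
    (fun q : R * R * R * R => let '(t, x, u, v) := q in f t x u v)); [|apply Hf].
  repeat apply continuous_pair; trivial.
Qed.

(** For distinct axes this is Schwarz's theorem on the plane through the point spanned by axes [i]
    and [j]. *)
Lemma pd_comm i j f t x u v : smooth f -> pd i (pd j f) t x u v = pd j (pd i f) t x u v.
Proof.
  intros Hf.
  assert (Hc : forall k l, jointly_continuous (pd k (pd l f)))
    by (intros k l; apply (class_C_continuous 0), smooth_pd, smooth_pd, Hf).
  destruct (axis_eq_dec i j) as [->|Hij]; [reflexivity|].
  (* [F a b] is [f] with coordinate [i] set to [a] and coordinate [j] set to [b]. *)
  pose (F := fun a b => slice j (fun t x u v => slice i f t x u v a) t x u v b).
  assert (H1 : locally_2d (fun a b => ex_derive (fun z => F z b) a /\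
     ex_derive (fun z => F a z) b /\
     ex_derive (fun z => Derive (fun s => F z s) b) a /\
     ex_derive (fun z => Derive (fun s => F s z) a) b) (coord i t x u v) (coord j t x u v)).
  (* The radius is arbitrary, since the derivatives exist everywhere. *)
  { exists (mkposreal 1 Rlt_0_1); intros a b _ _; unfold F.
    pose proof (fun t x u v => smooth_ex_derive i f t x u v Hf) as Hi.
    pose proof (fun t x u v => smooth_ex_derive j f t x u v Hf) as Hj.
    pose proof (fun t x u v => smooth_ex_derive i _ t x u v (smooth_pd j f Hf)) as Hij'.
    pose proof (fun t x u v => smooth_ex_derive j _ t x u v (smooth_pd i f Hf)) as Hji'.
    destruct i, j; try (exfalso; now apply Hij);
      exact (conj (Hi _ _ _ _) (conj (Hj _ _ _ _) (conj (Hij' _ _ _ _) (Hji' _ _ _ _)))). }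
  pose (p := fun k (q : R * R) => if axis_eq_dec k i then fst q
    else if axis_eq_dec k j then snd q else coord k t x u v).
  assert (Hp : forall k q, continuous (p k) q).
  { intros k q; unfold p; destruct (axis_eq_dec k i); [apply continuous_fst|].
    destruct (axis_eq_dec k j); [apply continuous_snd|apply continuous_const]. }
  assert (H2 : forall k l, continuity_2d_pt (fun a b =>
    slice j (fun t x u v => slice i (pd k (pd l f)) t x u v a) t x u v b)
     (coord i t x u v) (coord j t x u v)).
  { intros k l.
    pose proof (fun y z => jointly_continuous_2d _ (p T) (p X) (p U) (p V) y z
      (Hc k l) (Hp T) (Hp X) (Hp U) (Hp V)) as H.
    unfold p in H; destruct i, j; try (exfalso; now apply Hij); exact (H _ _). }
  pose proof (Schwarz F _ _ H1) as HS; unfold F in HS; clear F H1.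
  pose proof (H2 i j) as Hl; pose proof (H2 j i) as Hr.
  destruct i, j; try (exfalso; now apply Hij); exact (HS Hl Hr).
Qed.

(** * Functions with vanishing partial derivatives *)

Lemma pd_zero_slice i f t x u v s :
  smooth f -> (forall t x u v, pd i f t x u v = 0) ->
  slice i f t x u v s = slice i f t x u v 0.
Proof.
  intros Hf H0.
  assert (Hd : forall y, is_derive (slice i f t x u v) y 0).
  { intros y.
    assert (He : ex_derive (slice i f t x u v) y).
    { destruct i; [exact (smooth_ex_derive T f y x u v Hf)
        |exact (smooth_ex_derive X f t y u v Hf)
        |exact (smooth_ex_derive U f t x y v Hf)
        |exact (smooth_ex_derive V f t x u y Hf)]. }
    replace 0 with (Derive (slice i f t x u v) y); [now apply Derive_correct|].
    destruct i; [exact (H0 y x u v)|exact (H0 t y u v)|exact (H0 t x y v)|exact (H0 t x u y)]. }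
  destruct (MVT_gen (slice i f t x u v) 0 s (fun _ => 0)) as [c [_ Hc]].
  - intros y _; apply Hd.
  - intros y _; apply continuity_pt_filterlim, @ex_derive_continuous.
    exists 0; apply Hd.
  - lra.
Qed.

Lemma pd_zero_tx f t x u v :
  smooth f -> (forall t x u v, pd T f t x u v = 0) -> (forall t x u v, pd X f t x u v = 0) ->
  f t x u v = f 0 0 u v.
Proof.
  intros Hf Ht Hx; transitivity (f 0 x u v).
  - exact (pd_zero_slice T f t x u v t Hf Ht).
  - exact (pd_zero_slice X f 0 x u v x Hf Hx).
Qed.

Lemma pd_zero_const f t x u v :
  smooth f -> (forall i t x u v, pd i f t x u v = 0) -> f t x u v = f 0 0 0 0.
Proof.
  intros Hf H; rewrite (pd_zero_tx f t x u v Hf (H T) (H X)).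
  transitivity (f 0 0 0 v).
  - exact (pd_zero_slice U f 0 0 u v u Hf (H U)).
  - exact (pd_zero_slice V f 0 0 0 v v Hf (H V)).
Qed.

(** * Differentiation of identities and automation of the calculus rules *)

Lemma pd_ext i f g t x u v :
  (forall t x u v, f t x u v = g t x u v) -> pd i f t x u v = pd i g t x u v.
Proof. intros H; now rewrite (fun4_ext f g H). Qed.

Lemma smooth_opp f : smooth f -> smooth (fun t x u v => - f t x u v).
Proof.
  intros Hf; rewrite (fun4_ext _ (fun t x u v => -1 * f t x u v)) by (intros; ring).
  exact (smooth_mult _ _ (smooth_const _) Hf).
Qed.

Lemma smooth_minus f g :
  smooth f -> smooth g -> smooth (fun t x u v => f t x u v - g t x u v).
Proof. intros Hf Hg; exact (smooth_plus _ _ Hf (smooth_opp _ Hg)). Qed.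

Lemma pd_minus i f g t x u v :
  smooth f -> smooth g ->
  pd i (fun t x u v => f t x u v - g t x u v) t x u v = pd i f t x u v - pd i g t x u v.
Proof.
  intros Hf Hg.
  rewrite (pd_ext i _ (fun t x u v => f t x u v + -1 * g t x u v)) by (intros; ring).
  rewrite pd_plus, pd_mult, pd_const; trivial using smooth_const; [ring|].
  exact (smooth_mult _ _ (smooth_const _) Hg).
Qed.

Lemma smooth_pow f n : smooth f -> smooth (fun t x u v => f t x u v ^ n).
Proof.
  intros Hf; induction n as [|n IH]; [exact (smooth_const 1)|].
  exact (smooth_mult _ _ Hf IH).
Qed.

Ltac smooth_tac :=
  match goal with
  | |- smooth _ => assumption
  | |- smooth (pd _ _) => apply smooth_pd; smooth_tac
  | |- smooth (fun _ _ _ _ => ?c) => exact (smooth_const c)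
  | |- smooth (fun t x u v => t) => exact (smooth_coord T)
  | |- smooth (fun t x u v => x) => exact (smooth_coord X)
  | |- smooth (fun t x u v => u) => exact (smooth_coord U)
  | |- smooth (fun t x u v => v) => exact (smooth_coord V)
  | |- smooth (fun t x u v => _ + _) => apply smooth_plus; smooth_tac
  | |- smooth (fun t x u v => _ - _) => apply smooth_minus; smooth_tac
  | |- smooth (fun t x u v => _ * _) => apply smooth_mult; smooth_tac
  | |- smooth (fun t x u v => _ ^ ?n) => apply smooth_pow; smooth_tac
  end.

Lemma pd_pow2 i f t x u v :
  smooth f ->
  pd i (fun t x u v => f t x u v ^ 2) t x u v = 2 * f t x u v * pd i f t x u v.
Proof.
  intros Hf.
  rewrite (pd_ext i _ (fun t x u v => f t x u v * f t x u v)) by (intros; ring).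
  rewrite pd_mult; trivial; ring.
Qed.

(** [pd_coord] with the coordinate function unfolded, the form in which [pd_tac] meets it in
    goals. *)
Definition pd_t i := pd_coord i T : forall t x u v, pd i (fun t _ _ _ => t) t x u v = _.
Definition pd_x i := pd_coord i X : forall t x u v, pd i (fun _ x _ _ => x) t x u v = _.
Definition pd_u i := pd_coord i U : forall t x u v, pd i (fun _ _ u _ => u) t x u v = _.
Definition pd_v i := pd_coord i V : forall t x u v, pd i (fun _ _ _ v => v) t x u v = _.

Ltac pd_tac :=
  repeat first
    [ rewrite pd_const | rewrite pd_t | rewrite pd_x | rewrite pd_u | rewrite pd_v
    | rewrite pd_plus by smooth_tac | rewrite pd_minus by smooth_tac
    | rewrite pd_pow2 by smooth_tac | rewrite pd_mult by smooth_tac ];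
  cbn [axis_eq_dec axis_rec axis_rect].

(** * The determining equations *)

Definition determining (Q : vector_field) : Prop := forall t x u v,
  pd U (theta Q) t x u v = pd V (eta Q) t x u v /\
  pd V (theta Q) t x u v = pd U (eta Q) t x u v /\
  pd T (tau Q) t x u v + 2 * u * pd X (tau Q) t x u v = pd X (xi Q) t x u v /\
  eta Q t x u v = pd T (xi Q) t x u v + (u ^ 2 - 1) * pd X (tau Q) t x u v /\
  u * pd U (tau Q) t x u v - pd V (tau Q) t x u v = pd U (xi Q) t x u v /\
  u * pd V (tau Q) t x u v - pd U (tau Q) t x u v = pd V (xi Q) t x u v /\
  pd T (eta Q) t x u v + u * pd X (eta Q) t x u v + pd X (theta Q) t x u v = 0 /\
  pd T (theta Q) t x u v + u * pd X (theta Q) t x u v + pd X (eta Q) t x u v = 0.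

(** Both left-hand sides of [S0] are affine in each variable separately, so every derivative in
    [prolong1] is a slope read off from them. *)
Lemma Derive_affine (f : R -> R) a b y : (forall s, f s = a + b * s) -> Derive f y = b.
Proof.
  intros H; apply is_derive_unique, (is_derive_ext (fun s => a + b * s)); [easy|].
  auto_derive; [exact I|ring].
Qed.

Lemma prolong1_first Q t x u v ut ux vt vx :
  prolong1 Q (fun t x u v ut ux vt vx => ut + u * ux + vx) t x u v ut ux vt vx
  = eta Q t x u v * ux + eta_t Q t x u v ut ux vt vx + u * eta_x Q t x u v ut ux vt vx
    + theta_x Q t x u v ut ux vt vx.
Proof.
  unfold prolong1.
  rewrite (Derive_affine _ (ut + u * ux + vx) 0 t), (Derive_affine _ (ut + u * ux + vx) 0 x),
    (Derive_affine _ (ut + vx) ux u), (Derive_affine _ (ut + u * ux + vx) 0 v),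
    (Derive_affine _ (u * ux + vx) 1 ut), (Derive_affine _ (ut + vx) u ux),
    (Derive_affine _ (ut + u * ux + vx) 0 vt), (Derive_affine _ (ut + u * ux) 1 vx)
    by (intros; ring).
  ring.
Qed.

Lemma prolong1_second Q t x u v ut ux vt vx :
  prolong1 Q (fun t x u v ut ux vt vx => vt + u * vx + ux) t x u v ut ux vt vx
  = eta Q t x u v * vx + theta_t Q t x u v ut ux vt vx + u * theta_x Q t x u v ut ux vt vx
    + eta_x Q t x u v ut ux vt vx.
Proof.
  unfold prolong1.
  rewrite (Derive_affine _ (vt + u * vx + ux) 0 t), (Derive_affine _ (vt + u * vx + ux) 0 x),
    (Derive_affine _ (vt + ux) vx u), (Derive_affine _ (vt + u * vx + ux) 0 v),
    (Derive_affine _ (vt + u * vx + ux) 0 ut), (Derive_affine _ (vt + u * vx) 1 ux),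
    (Derive_affine _ (u * vx + ux) 1 vt), (Derive_affine _ (vt + ux) u vx)
    by (intros; ring).
  ring.
Qed.

(** Once u_t and v_t are eliminated, both conditions are polynomials of degree at most 2 in u_x,
    v_x. The constant terms give the last two determining equations, the quadratic terms the two for
    xi_u and xi_v, and sums and differences of the linear terms the first four. *)
Lemma invariance_determining Q :
  max_lie_invariance_algebra S0 Q <-> smooth_vf Q /\ determining Q.
Proof.
  unfold max_lie_invariance_algebra; split; intros [HQ H]; (split; [exact HQ|]).
  - intros t x u v.
    (* The values 0, 1, -1 of u_x and v_x separate the coefficients of the two
       quadratic polynomials; the u_x v_x terms cancel identically. *)
    assert (H1 : forall p q, prolong1 Q (fun t x u v ut ux vt vx => ut + u * ux + vx)
      t x u v (- (u * p) - q) p (- (u * q) - p) q = 0).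
    { intros p q; apply H; [now left|].
      intros F' [<-|[<-|[]]]; ring. }
    assert (H2 : forall p q, prolong1 Q (fun t x u v ut ux vt vx => vt + u * vx + ux)
      t x u v (- (u * p) - q) p (- (u * q) - p) q = 0).
    { intros p q; apply H; [now right; left|].
      intros F' [<-|[<-|[]]]; ring. }
    clear H.
    pose proof (fun p q => eq_trans (eq_sym (prolong1_first _ _ _ _ _ _ _ _ _)) (H1 p q)) as H1'.
    pose proof (fun p q => eq_trans (eq_sym (prolong1_second _ _ _ _ _ _ _ _ _)) (H2 p q)) as H2'.
    clear H1 H2.
    unfold eta_t, eta_x, theta_t, theta_x, total_t, total_x in H1', H2'.
    pose proof (H1' 0 0); pose proof (H1' 1 0); pose proof (H1' (-1) 0);
      pose proof (H1' 0 1); pose proof (H1' 0 (-1)).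
    pose proof (H2' 0 0); pose proof (H2' 1 0); pose proof (H2' (-1) 0);
      pose proof (H2' 0 1); pose proof (H2' 0 (-1)).
    clear H1' H2'.
    cbn [pd].
    assert (E3 : d_t (tau Q) t x u v + 2 * u * d_x (tau Q) t x u v = d_x (xi Q) t x u v) by lra.
    (* The equation for eta needs u xi_x eliminated; [lra] cannot multiply [E3] by the variable [u]
       itself. *)
    pose proof (f_equal (Rmult u) E3).
    repeat split; lra.
  - intros F HF t x u v ut ux vt vx HS.
    pose proof (HS _ (or_introl eq_refl)) as Hut; cbv beta in Hut.
    pose proof (HS _ (or_intror (or_introl eq_refl))) as Hvt; cbv beta in Hvt.
    assert (ut = - (u * ux) - vx) as -> by lra.
    assert (vt = - (u * vx) - ux) as -> by lra.
    clear HS Hut Hvt.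
    destruct (H t x u v) as (E1 & E2 & E3 & E4 & E5 & E6 & E7 & E8); clear H HQ.
    cbn [pd] in *.
    assert (E7' : d_t (eta Q) t x u v = - (u * d_x (eta Q) t x u v) - d_x (theta Q) t x u v) by lra.
    assert (E8' : d_t (theta Q) t x u v = - (u * d_x (theta Q) t x u v) - d_x (eta Q) t x u v) by lra.
    (* The equations serve as substitutions for theta_u, theta_v, xi_x, xi_u, xi_v, eta_t, theta_t
       and eta, after which a polynomial identity remains. *)
    destruct HF as [<-|[<-|[]]]; rewrite ?prolong1_first, ?prolong1_second;
      unfold eta_t, eta_x, theta_t, theta_x, total_t, total_x;
      rewrite E1, E2, <- E3, <- E5, <- E6, ?E7', ?E8', E4; ring.
Qed.

(** * The span of the generators solves the determining equations *)

Lemma determining_zero : determining vf_zero.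
Proof. intros t x u v; cbn [tau xi eta theta vf_zero]; pd_tac; repeat split; ring. Qed.

Lemma smooth_vf_lin c Y Z :
  smooth_vf Y -> smooth_vf Z -> smooth_vf (vf_plus (vf_scal c Y) Z).
Proof.
  intros (? & ? & ? & ?) (? & ? & ? & ?); repeat split;
    cbn [tau xi eta theta vf_plus vf_scal]; smooth_tac.
Qed.

Lemma determining_lin c Y Z :
  smooth_vf Y -> smooth_vf Z -> determining Y -> determining Z ->
  determining (vf_plus (vf_scal c Y) Z).
Proof.
  intros (? & ? & ? & ?) (? & ? & ? & ?) HY HZ t x u v.
  cbn [tau xi eta theta vf_plus vf_scal]; pd_tac.
  destruct (HY t x u v) as (E1 & E2 & E3 & E4 & E5 & E6 & E7 & E8).
  destruct (HZ t x u v) as (F1 & F2 & F3 & F4 & F5 & F6 & F7 & F8).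
  rewrite E1, E2, <- E3, E4, <- E5, <- E6, F1, F2, <- F3, F4, <- F5, <- F6.
  repeat split; try ring.
  - pose proof (f_equal (Rmult c) E7); lra.
  - pose proof (f_equal (Rmult c) E8); lra.
Qed.

Lemma generator_determining Y : g0_generator Y -> smooth_vf Y /\ determining Y.
Proof.
  intros [| |tau0 xi0 (Ht & Hx & Heq)| |]; split;
    try (repeat split; cbn [tau xi eta theta vf_D vf_G vf_P vf_Pv vf_J]; smooth_tac);
    intros t x u v; cbn [tau xi eta theta vf_D vf_G vf_P vf_Pv vf_J];
    try (pd_tac; repeat split; field).
  (* Only [vf_P] remains. Its coefficients do not depend on t and x, and the defining system of
     (tau0, xi0) is exactly the pair of equations for xi_u and xi_v. *)
  destruct (Heq u v) as [E5 E6].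
  assert (Hz : forall (f : R -> R -> R), pd T (fun _ _ u v => f u v) t x u v = 0 /\
    pd X (fun _ _ u v => f u v) t x u v = 0).
  { intros f; split; exact (Derive_const _ _). }
  rewrite !(proj1 (Hz _)), !(proj2 (Hz _)), !pd_const; repeat split; try ring.
  - exact E5.
  - exact E6.
Qed.

Lemma span_determining Q : span g0_generator Q -> smooth_vf Q /\ determining Q.
Proof.
  intros [l [Hl ->]]; induction Hl as [|[c Y] l HY _ [IHs IHd]].
  - split; [repeat split; exact (smooth_const 0)|apply determining_zero].
  - apply generator_determining in HY as [HYs HYd]; cbn [snd] in *; split.
    + now apply smooth_vf_lin.
    + now apply determining_lin.
Qed.

(** * Integration of the determining equations *)

Lemma determining_eta_theta_tx Q i t x u v :
  smooth_vf Q -> determining Q -> i = T \/ i = X ->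
  pd i (eta Q) t x u v = 0 /\ pd i (theta Q) t x u v = 0.
Proof.
  intros (St & Sx & Se & Sh) H Hi.
  assert (E1 := fun t x u v => proj1 (H t x u v)).
  assert (E2 := fun t x u v => proj1 (proj2 (H t x u v))).
  assert (E7 : forall t x u v,
    pd T (eta Q) t x u v + u * pd X (eta Q) t x u v + pd X (theta Q) t x u v = 0) by apply H.
  assert (E8 : forall t x u v,
    pd T (theta Q) t x u v + u * pd X (theta Q) t x u v + pd X (eta Q) t x u v = 0) by apply H.
  assert (E1d := fun j => pd_ext j _ _ t x u v E1).
  assert (E2d := fun j => pd_ext j _ _ t x u v E2).
  (* Modulo theta_u = eta_v and theta_v = eta_u, the u-derivative of [E7] and the v-derivative of
     [E8] differ only by eta_x, and the u-derivative of [E8] and the v-derivative of [E7] only by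
     theta_x. Hence eta_x = theta_x = 0, and [E7], [E8] then give eta_t = theta_t = 0. *)
  assert (E7U := pd_ext U _ _ t x u v E7); assert (E7V := pd_ext V _ _ t x u v E7).
  assert (E8U := pd_ext U _ _ t x u v E8); assert (E8V := pd_ext V _ _ t x u v E8).
  revert E7U E7V E8U E8V; pd_tac.
  rewrite !(pd_comm U), !(pd_comm V) by assumption.
  rewrite !E1d, !E2d; intros E7U E7V E8U E8V.
  specialize (E7 t x u v); specialize (E8 t x u v).
  assert (Hex : pd X (eta Q) t x u v = 0) by lra.
  assert (Hhx : pd X (theta Q) t x u v = 0) by lra.
  rewrite Hex, Hhx in *.
  destruct Hi as [-> | ->]; split; lra.
Qed.

Lemma determining_span Q : smooth_vf Q -> determining Q -> span g0_generator Q.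
Proof.
  intros HS H.
  assert (Z := fun i t x u v Hi => determining_eta_theta_tx Q i t x u v HS H Hi).
  destruct HS as (St & Sx & Se & Sh).
  assert (ZeT := fun t x u v => proj1 (Z T t x u v (or_introl eq_refl))).
  assert (ZhT := fun t x u v => proj2 (Z T t x u v (or_introl eq_refl))).
  assert (ZeX := fun t x u v => proj1 (Z X t x u v (or_intror eq_refl))).
  assert (ZhX := fun t x u v => proj2 (Z X t x u v (or_intror eq_refl))).
  clear Z.
  assert (E1 := fun t x u v => proj1 (H t x u v)).
  assert (E2 := fun t x u v => proj1 (proj2 (H t x u v))).
  assert (E3 := fun t x u v => proj1 (proj2 (proj2 (H t x u v)))).
  assert (E4 := fun t x u v => proj1 (proj2 (proj2 (proj2 (H t x u v))))).
  assert (E5 := fun t x u v => proj1 (proj2 (proj2 (proj2 (proj2 (H t x u v)))))).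
  assert (E6 := fun t x u v => proj1 (proj2 (proj2 (proj2 (proj2 (proj2 (H t x u v))))))).
  clear H.
  assert (C1 : forall t x u v,
    pd U (eta Q) t x u v = 0 /\ 2 * pd X (tau Q) t x u v = pd V (eta Q) t x u v).
  { intros t x u v.
    (* Equate the two expressions of xi_xu, xi_xv, xi_tu and xi_tv. *)
    assert (E3U := pd_ext U _ _ t x u v E3); assert (E3V := pd_ext V _ _ t x u v E3).
    assert (E4U := pd_ext U _ _ t x u v E4); assert (E4V := pd_ext V _ _ t x u v E4).
    assert (E5X := pd_ext X _ _ t x u v E5); assert (E5T := pd_ext T _ _ t x u v E5).
    assert (E6X := pd_ext X _ _ t x u v E6); assert (E6T := pd_ext T _ _ t x u v E6).
    revert E3U E3V E4U E4V E5X E5T E6X E6T; pd_tac.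
    rewrite !(pd_comm U), !(pd_comm V) by assumption; intros.
    (* [A] compares the two values of xi_xu, [B] those of xi_xv. With them the second derivatives of
       tau cancel from the comparisons for xi_tu and xi_tv, leaving eta_u = 0 and eta_v = 2
       tau_x. *)
    assert (A : pd T (pd U (tau Q)) t x u v = - u * pd X (pd U (tau Q)) t x u v
      - pd X (pd V (tau Q)) t x u v - 2 * pd X (tau Q) t x u v) by lra.
    assert (B : pd T (pd V (tau Q)) t x u v = - u * pd X (pd V (tau Q)) t x u v
      - pd X (pd U (tau Q)) t x u v) by lra.
    rewrite A, B in *; split; lra. }
  assert (EU := fun t x u v => proj1 (C1 t x u v)).
  assert (TX := fun t x u v => proj2 (C1 t x u v)); clear C1.
  (* These values at the origin become the coefficients of [vf_G], [vf_Pv], [vf_J] and [vf_D], for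
     [a], [b], [c] and [d] respectively. *)
  pose (a := eta Q 0 0 0 0); pose (b := theta Q 0 0 0 0).
  pose (c := pd V (eta Q) 0 0 0 0); pose (d := pd T (tau Q) 0 0 0 0).
  assert (EV : forall t x u v, pd V (eta Q) t x u v = c).
  { intros t x u v; apply pd_zero_const; [now apply smooth_pd|].
    clear t x u v; intros [] t x u v.
    - rewrite pd_comm by assumption; rewrite (pd_ext V _ _ _ _ _ _ ZeT); apply pd_const.
    - rewrite pd_comm by assumption; rewrite (pd_ext V _ _ _ _ _ _ ZeX); apply pd_const.
    - rewrite pd_comm by assumption; rewrite (pd_ext V _ _ _ _ _ _ EU); apply pd_const.
    (* eta_vv = theta_uv = theta_vu = eta_uu = 0. *)
    - rewrite <- (pd_ext V _ _ _ _ _ _ E1), pd_comm by assumption.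
      rewrite (pd_ext U _ _ _ _ _ _ E2), (pd_ext U _ _ _ _ _ _ EU); apply pd_const. }
  assert (He : forall t x u v, eta Q t x u v = c * v + a).
  { intros t x u v.
    (* The difference eta - c v has zero gradient, so it equals its value [a] at the origin; theta
       and tau_t are treated likewise below. *)
    assert (K := pd_zero_const (fun t x u v => eta Q t x u v - c * v) t x u v).
    cbv beta in K; fold a in K; rewrite <- (Rplus_minus (c * v) (eta Q t x u v)), K; [ring|smooth_tac|].
    clear t x u v K; intros i t x u v; pd_tac.
    destruct i; rewrite ?ZeT, ?ZeX, ?EU, ?EV; cbn; ring. }
  assert (Hh : forall t x u v, theta Q t x u v = c * u + b).
  { intros t x u v.
    assert (K := pd_zero_const (fun t x u v => theta Q t x u v - c * u) t x u v).
    cbv beta in K; fold b in K; rewrite <- (Rplus_minus (c * u) (theta Q t x u v)), K; [ring|smooth_tac|].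
    clear t x u v K; intros i t x u v; pd_tac.
    destruct i; rewrite ?ZhT, ?ZhX, ?E1, ?E2, ?EU, ?EV; cbn; ring. }
  assert (HX : forall t x u v, pd X (tau Q) t x u v = c / 2)
    by (intros; rewrite <- (EV t x u v), <- TX; field).
  assert (HXd : forall i t x u v, pd i (pd X (tau Q)) t x u v = 0)
    by (intros; rewrite (pd_ext i _ _ _ _ _ _ HX); apply pd_const).
  assert (HT : forall t x u v, pd T (tau Q) t x u v = d - c * u).
  { intros t x u v.
    assert (K := pd_zero_const (fun t x u v => pd T (tau Q) t x u v + c * u) t x u v).
    cbv beta in K; fold d in K.
    rewrite <- (Rplus_minus (- (c * u)) (pd T (tau Q) t x u v)).
    transitivity (- (c * u) + (pd T (tau Q) t x u v + c * u)); [ring|].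
    rewrite K; [ring|smooth_tac|].
    clear t x u v K; intros i t x u v; pd_tac.
    (* As tau_x is constant and eta_x = 0, the x-derivatives of [E4], [E5], [E6] give xi_xt = 0,
       xi_xu = - tau_xv = 0 and xi_xv = 0. Differentiating [E3] then yields tau_tt = tau_tv = 0 and
       tau_tu = -2 tau_x = -c. *)
    assert (E3d := fun i => pd_ext i _ _ t x u v E3).
    assert (E5X := pd_ext X _ _ t x u v E5).
    assert (E6X := pd_ext X _ _ t x u v E6).
    assert (E4X := pd_ext X _ _ t x u v E4).
    assert (E3T := E3d T); assert (E3U := E3d U); assert (E3V := E3d V); clear E3d.
    revert E3T E3U E3V E5X E6X E4X; pd_tac.
    rewrite !(pd_comm X U), !(pd_comm X V), !(pd_comm X T), !HXd, ZeX, HX by assumption.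
    destruct i; cbn [axis_eq_dec axis_rec axis_rect]; intros; try lra.
    rewrite pd_comm, HXd by assumption; lra. }
  clearbody a b c d.
  (* What is left of tau and xi after removing the contributions of d [vf_D], a [vf_G] and c [vf_J].
     Both remainders are independent of t and x, so they equal tau and xi at t = x = 0 and form the
     [vf_P] term. *)
  set (gt := fun t x u v => tau Q t x u v - (c / 2 * x + (d - c * u) * t)).
  set (gx := fun t x u v => xi Q t x u v - (d * x + t * (c * v + a - (u ^ 2 - 1) * (c / 2)))).
  assert (Sgt : smooth gt) by (unfold gt; smooth_tac).
  assert (Sgx : smooth gx) by (unfold gx; smooth_tac).
  assert (Kt : forall t x u v, gt t x u v = tau Q 0 0 u v).
  { intros t x u v; rewrite pd_zero_tx; [unfold gt; ring|assumption| |];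
      clear t x u v; intros t x u v; unfold gt; pd_tac; rewrite ?HT, ?HX; field. }
  assert (Kx : forall t x u v, gx t x u v = xi Q 0 0 u v).
  { intros t x u v; rewrite pd_zero_tx; [unfold gx; ring|assumption| |];
      clear t x u v; intros t x u v; unfold gx; pd_tac.
    - specialize (E4 t x u v); rewrite He, HX in E4; lra.
    - rewrite <- E3, HT, HX; field. }
  exists [(d, vf_D); (a, vf_G); (1, vf_P (fun u v => tau Q 0 0 u v) (fun u v => xi Q 0 0 u v));
    (b, vf_Pv); (c, vf_J)]; split.
  - repeat apply Forall_cons; try apply Forall_nil; cbn [snd]; constructor.
    split; [|split].
    (* The restriction to t = x = 0, extended constantly in t and x, is smooth because it coincides
       with [gt]. *)
    + now rewrite <- (fun4_ext _ _ Kt).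
    + now rewrite <- (fun4_ext _ _ Kx).
    + intros u v; exact (conj (E5 0 0 u v) (E6 0 0 u v)).
  - unfold gt in Kt; unfold gx in Kx;
    destruct Q as [f g h k]; cbn in *.
    unfold vf_plus; cbn; f_equal; apply fun4_ext; intros t x u v.
    + rewrite <- (Kt t x u v); field.
    + rewrite <- (Kx t x u v); field.
    + rewrite He; ring.
    + rewrite Hh; ring.
Qed.

Theorem theorem15 (Q : vector_field) :
  max_lie_invariance_algebra S0 Q <-> span g0_generator Q.
Proof.
  rewrite invariance_determining; split.
  - intros [HS HD]; now apply determining_span.
  - apply span_determining.
Qed.
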